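(* Let $q$ be a prime power with $q\equiv 1\pmod 4$ and $q\neq 5$. Then the Paley graph $P(q)$ is pancyclic.
   Context: For a prime power $q\equiv 1\pmod 4$, let $\mathbb{F}_q$ be the finite field of order $q$ and let $(\mathbb{F}_q^* )^2$ be the set of nonzero squares (quadratic residues) of $\mathbb{F}_q$. The Paley graph $P(q)$ is the simple undirected graph with vertex set $\mathbb{F}_q$ in which $u$ and $v$ are adjacent if and only if $u-v\in(\mathbb{F}_q^* )^2$ (this is the Cayley graph $\mathrm{Cay}(\mathbb{F}_q,(\mathbb{F}_q^* )^2)$ of the additive group of $\mathbb{F}_q$). An undirected graph of order $n\ge 3$ is pancyclic if it contains a $k$-cycle as a (not necessarily induced) subgraph for every $k\in\{3,4,\ldots,n\}$. *)

(* Defs.v *)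
From mathcomp Require Import all_boot all_algebra all_field.
Set Implicit Arguments.
Unset Strict Implicit.
Unset Printing Implicit Defensive.
Import GRing.Theory.
Local Open Scope ring_scope.

Record sgraph (V : finType) := SGraph {
  adj :> rel V;
  adj_sym : symmetric adj;
  adj_irrefl : irreflexive adj
}.

(* For k >= 3 a k-cycle is a cyclic sequence of k distinct vertices, consecutive
   ones (the last and the first included) being adjacent.  The bound on k must
   be kept: [ucycle] also accepts the two-element sequence of an edge. *)
Definition has_cycle_of_length (V : finType) (G : sgraph V) (k : nat) : Prop :=
  (3 <= k)%N /\ exists c : seq V, size c = k /\ ucycle G c.

Definition pancyclic (V : finType) (G : sgraph V) : Prop :=
  (3 <= #|V|)%N /\
  forall k : nat, (3 <= k <= #|V|)%N -> has_cycle_of_length G k.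

Section Paley.
Variable F : finFieldType.

Definition nonzero_squares : {set F} := [set y ^+ 2 | y : F & y != 0].

Definition paley_adj : rel F := fun u v => u - v \in nonzero_squares.

Lemma paley_adj_irrefl : irreflexive paley_adj.
Proof.
move=> u; apply/negbTE/imsetP => -[y]; rewrite inE subrr => y0 /esym/eqP.
by rewrite expf_eq0 /= (negbTE y0).
Qed.

Lemma sqrt_opp1_exists (q : nat) :
  #|F| = q -> q = 1 %[mod 4] -> exists i : F, i ^+ 2 = -1.
Proof.
move=> Fq q1; set m := (q %/ 4)%N.
have qE : q = (m * 4).+1 by rewrite {1}(divn_eq q 4) q1 addn1.
have m_gt0 : (0 < m)%N.
  by have := card_finNzRing_gt1 F; rewrite Fq qE ltnS muln_gt0 andbT.
case: (pickP [pred a : F | (a != 0) && (a ^+ (m * 2) != 1)]) => [a | no_a].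
  case/andP=> a0 a1; exists (a ^+ m); apply/eqP; rewrite -exprM.
  have := expf_card a; rewrite Fq qE exprS => /eqP.
  rewrite -[X in _ == X]mulr1 (inj_eq (mulfI a0)) -[4%N]/(2 * 2)%N mulnA exprM.
  by rewrite sqrf_eq1 (negbTE a1).
have pn0 : 'X^(m * 2) - 1 != 0 :> {poly F}.
  by apply: monic_neq0; apply: monicXnsubC; rewrite muln_gt0 m_gt0.
have := @max_poly_roots _ _ (enum (predC1 (0 : F))) pn0.
have -> : all (root ('X^(m * 2) - 1)) (enum (predC1 (0 : F))).
  apply/allP => x; rewrite mem_enum inE => x0.
  have /= := no_a x; rewrite x0 /= => /negbFE/eqP xm.
  by rewrite rootE !hornerE xm subrr.
rewrite enum_uniq size_XnsubC ?muln_gt0 ?m_gt0 // -cardE.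
have -> : #|predC1 (0 : F)| = (m * 4)%N by rewrite cardC1 Fq qE.
by move=> /(_ isT isT); rewrite ltnS leq_mul2l eqn0Ngt m_gt0.
Qed.

Lemma paley_adj_sym (q : nat) :
  #|F| = q -> q = 1 %[mod 4] -> symmetric paley_adj.
Proof.
move=> Fq q1; have [i i2] := sqrt_opp1_exists Fq q1.
have i0 : i != 0 by rewrite -sqrf_eq0 i2 oppr_eq0 oner_eq0.
suff H u v : paley_adj u v -> paley_adj v u by move=> u v; apply/idP/idP; apply: H.
case/imsetP=> y; rewrite inE => y0 uv; apply/imsetP; exists (i * y).
  by rewrite inE mulf_neq0.
by rewrite exprMn i2 mulN1r -uv opprB.
Qed.

Definition paley_graph (q : nat) (Fq : #|F| = q) (q1 : q = 1 %[mod 4]) :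
    sgraph F :=
  SGraph (paley_adj_sym Fq q1) paley_adj_irrefl.

End Paley.

Definition prime_power (q : nat) : Prop :=
  exists p k : nat, [/\ prime p, (0 < k)%N & q = (p ^ k)%N].

(* Main.v *)
Require Import Defs.
From mathcomp Require Import all_boot all_order all_algebra all_field.
From mathcomp Require Import zify ring.

(** The proof goes up one length at a time: a triangle exists, and a cycle [C]
    of length [k < q] forces a cycle of length [k + 1].

    Suppose that there is no cycle of length [k + 1]. For a vertex [x] off
    [C], the rotation argument of Dirac and Ore shows that [x] and the
    successors on [C] of its neighbours form an independent set
    ([successors_independent]). Independent sets of the Paley graph have at
    most [sqrt q] elements ([independent_le]), so every vertex off [C] has
    fewer than [sqrt q] neighbours on [C]: few edges leave [C]. But the Paley
    graph is an expander ([seidel_mixing]), and about half of the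
    [k * (q - k)] pairs between [C] and its complement are edges; this forces
    [k <= 2 * sqrt q]. On the other hand, an edge of [C] lies in [(q - 5) / 4]
    triangles ([card_common]), and their third vertices are all on [C], since
    otherwise they could be inserted into the cycle. So every vertex of [C]
    has at least [(q - 1) / 4] neighbours on [C], which by the same expansion
    is possible only if [k] is at least about [(q - sqrt q) / 2].

    The two bounds on [k] are incompatible unless [q <= 25]
    ([bounds_exceptional]), and the seven pairs [(q, k)] that they leave are
    settled by explicit cycles ([exceptional_cycle]): in the fields of order
    13 and 17 by steps of 1 and 4, which are always squares, and in those of
    order 9 and 25 on a torus spanned by 1 and a square off the prime field.

    Both facts on the graph, expansion and the count of triangles, come from
    the quadratic character [chi]: its autocorrelation
    [\sum_x chi x * chi (x + c)] is [-1] for every [c != 0]. *)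

Import Order.TTheory GRing.Theory Num.Theory.
Set Implicit Arguments.
Unset Strict Implicit.
Unset Printing Implicit Defensive.

(** * Lengthening a cycle by one vertex *)

Section CycleExtension.
Variables (V : finType) (G : sgraph V).

Lemma next_rcons_last (s : seq V) y :
  uniq (rcons s y) -> next (rcons s y) y = head y s.
Proof.
move=> us; have -> : next (rcons s y) y = next (rotr 1 (rcons s y)) y.
  by rewrite next_rotr.
by rewrite rotr1_rcons; case: s us => [|a s] us /=; rewrite eqxx.
Qed.

Lemma next_cat_cons (s t : seq V) z a :
  uniq (s ++ z :: a :: t) -> next (s ++ z :: a :: t) z = a.
Proof.
move=> us.
have -> : next (s ++ z :: a :: t) z =
          next (rot (size s) (s ++ z :: a :: t)) z.
  by rewrite next_rot.
by rewrite rot_size_cat /= eqxx.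
Qed.

(** A cycle can be opened just after any of its vertices: both surgeries below
    read it from the successor of [y] round to [y]. *)
Lemma ucycle_ending_at (c : seq V) y : ucycle G c -> y \in c ->
  exists s, [/\ ucycle G (rcons s y), perm_eq (rcons s y) c &
    next (rcons s y) =1 next c].
Proof.
case/andP=> cc uc /rot_to [i s def_s]; exists s.
have -> : rcons s y = rot 1 (rot i c) by rewrite def_s rot1_cons.
rewrite /ucycle !rot_cycle !rot_uniq cc uc; split => //.
  by rewrite perm_rot perm_rot.
by move=> z; rewrite !next_rot ?rot_uniq.
Qed.

Lemma cycle_insert c x y : 3 <= size c -> ucycle G c -> x \notin c ->
  y \in c -> G x y -> G x (next c y) -> has_cycle_of_length G (size c).+1.
Proof.
move=> c3 uc xc yc xy; have [s [/andP[cs us] eqs <-]] := ucycle_ending_at uc yc.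
rewrite next_rcons_last // => xy'; split; first by rewrite ltnS ltnW.
exists (x :: rcons s y); split; first by rewrite /= (perm_size eqs).
rewrite /ucycle cons_uniq (perm_mem eqs) xc us andbT.
move: c3; rewrite -(perm_size eqs).
case: s {us} cs eqs xy' => [|a s] //= cs eqs xy' _.
move: cs; rewrite ![path _ _ (rcons (rcons _ _) _)]rcons_path !last_rcons.
case/andP=> -> _.
by rewrite xy' [G y x]adj_sym xy.
Qed.

(** The rotation argument of Dirac and Ore. Opened after [y], the cycle reads
    [y' ... z z' ... y] with [y'] and [z'] the successors of [y] and [z]; if
    [y'] and [z'] are adjacent, then [x z ... y' z' ... y] is a cycle through
    [x]. *)
Lemma cycle_crossing c x y z : 3 <= size c -> ucycle G c -> x \notin c ->
  y \in c -> z \in c -> y != z -> G x y -> G x z -> G (next c y) (next c z) ->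
  has_cycle_of_length G (size c).+1.
Proof.
move=> c3 uc xc yc; have [s [/andP[cs us] eqs eqn]] := ucycle_ending_at uc yc.
rewrite -(perm_mem eqs z) mem_rcons inE => /orP[/eqP->|zs].
  by rewrite eqxx.
move=> yz xy xz; rewrite -!eqn {eqn}.
case/splitPr: zs cs us eqs => s1 s2; rewrite rcons_cat rcons_cons => cs us eqs.
have -> : next (s1 ++ z :: rcons s2 y) y = head z s1.
  by move: us; rewrite -rcons_cons -rcons_cat => /next_rcons_last->; case: (s1).
have -> : next (s1 ++ z :: rcons s2 y) z = head y s2.
  by case: (s2) us => [|a t] /= us; rewrite next_cat_cons.
move=> yz'; split; first by rewrite ltnS ltnW.
exists (x :: rev (rcons s1 z) ++ rcons s2 y); split.
  by rewrite /= -(perm_size eqs) !size_cat size_rev size_rcons /= addSnnS.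
have pm : perm_eq (rev (rcons s1 z) ++ rcons s2 y) c.
  by apply: perm_trans eqs; rewrite -cat_rcons perm_cat2r perm_rev.
rewrite /ucycle cons_uniq (perm_mem pm) xc (perm_uniq pm) (andP uc).2 /= andbT.
have adjC a b : G b a = G a b by rewrite adj_sym.
move: cs; rewrite (cycle_path y) last_cat /= last_rcons cat_path /=.
case/and3P=> cs1 s1z s2y; rewrite rev_rcons /= xz /= rcons_path cat_path.
rewrite last_cat last_rcons [G y x]adj_sym xy andbT.
apply/andP; split.
  case: (s1) cs1 s1z => [|a p] /=; first by [].
  case/andP=> _ ap pz.
  have := rev_path G a (rcons p z); rewrite last_rcons belast_rcons => ->.
  by rewrite (eq_path adjC) rcons_path ap.
have -> : last z (rev s1) = head z s1.
  by case: (s1) => [|a p] //; rewrite rev_cons last_rcons.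
case: (s2) s2y yz' => [|b t] /=; rewrite ?andbT //; by case/andP=> _ -> ->.
Qed.

(** The two surgeries together: if no cycle is one longer, then [x] and the
    successors of its neighbours on the cycle are pairwise non-adjacent. So a
    bound on independent sets bounds the number of these neighbours. *)
Lemma successors_independent c x : 3 <= size c -> ucycle G c -> x \notin c ->
  ~ has_cycle_of_length G (size c).+1 ->
  exists2 I : {set V}, #|I| = #|[set y in c | G x y]|.+1 &
    {in I &, forall u v, ~~ G u v}.
Proof.
move=> c3 uc xc noext; have /andP[_ uniqc] := uc.
pose N := [set y in c | G x y].
have succN : x \notin next c @: N.
  apply: contra xc => /imsetP[y]; rewrite inE => /andP[yc _] ->.
  by rewrite mem_next.
exists (x |: next c @: N).
  by rewrite cardsU1 succN card_imset //; apply: can_inj (prev_next uniqc).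
have xnext y : y \in N -> ~~ G x (next c y).
  rewrite inE => /andP[yc xy]; apply/negP => xy'; apply: noext.
  exact: cycle_insert xy xy'.
move=> u v /setU1P[->|/imsetP[y yN ->]] /setU1P[->|/imsetP[z zN ->]].
- by rewrite adj_irrefl.
- exact: xnext.
- by rewrite adj_sym; apply: xnext.
have [->|yz] := eqVneq y z; first by rewrite adj_irrefl.
move: yN zN; rewrite !inE => /andP[yc xy] /andP[zc xz].
apply/negP => yz'; apply: noext.
exact: (cycle_crossing c3 uc xc yc zc yz xy xz).
Qed.
End CycleExtension.

Local Open Scope ring_scope.

(** * The quadratic character and its correlations *)

Section QuadraticCharacter.
Variables (F : finFieldType).
Hypothesis two_neq0 : 2 != 0 :> F.
Local Notation S := (nonzero_squares F).
Local Notation q := #|F|.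

Lemma sqr_mem (x : F) : x != 0 -> x ^+ 2 \in S.
Proof. by move=> x0; apply/imsetP; exists x; rewrite ?inE. Qed.

Lemma square_neq0 x : x \in S -> x != 0.
Proof. by case/imsetP=> y; rewrite inE => y0 ->; rewrite expf_neq0. Qed.

Lemma one_square : 1 \in S.
Proof. by rewrite -(expr1n _ 2) sqr_mem ?oner_neq0. Qed.

Lemma squareM x y : x \in S -> y \in S -> x * y \in S.
Proof.
case/imsetP=> a; rewrite inE => a0 ->; case/imsetP=> b; rewrite inE => b0 ->.
by rewrite -exprMn sqr_mem ?mulf_neq0.
Qed.

Lemma squareV x : x \in S -> x^-1 \in S.
Proof.
by case/imsetP=> a + ->; rewrite !inE => a0; rewrite -exprVn sqr_mem ?invr_neq0.
Qed.

Lemma square_pMl x y : x \in S -> (x * y \in S) = (y \in S).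
Proof.
move=> Sx; apply/idP/idP => [Sxy|]; last exact: squareM.
by rewrite -(mulKf (square_neq0 Sx) y) squareM ?squareV.
Qed.

Lemma card_squares : (#|S| * 2)%N = q.-1.
Proof.
rewrite -(cardC1 (0 : F)) -[RHS]sum1_card.
rewrite (partition_big (fun y : F => y ^+ 2) (mem S)) /=; last exact: sqr_mem.
rewrite -sum_nat_const; apply: eq_bigr => s /imsetP[y]; rewrite inE => y0 ->.
have yNy : y != - y by rewrite -subr_eq0 opprK -mulr2n -mulr_natl mulf_neq0.
transitivity #|[set y; - y]|; first by rewrite cards2 yNy.
rewrite sum1dep_card; apply: eq_card => z.
rewrite !inE eqf_sqr andb_idl //.
by case/orP=> /eqP->; rewrite ?oppr_eq0.
Qed.

Lemma card_nonsquares : #|[set x | (x != 0) && (x \notin S)]| = #|S|.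
Proof.
have := card_squares; rewrite -(cardC1 (0 : F)).
rewrite -(cardID (mem S) (predC1 0)).
have -> : #|[predI predC1 0 & mem S]| = #|S|.
  apply: eq_card => x; rewrite !inE andb_idl //.
  exact: square_neq0.
have -> : #|[predD predC1 0 & mem S]| = #|[set x | (x != 0) && (x \notin S)]|.
  by apply: eq_card => x; rewrite !inE andbC.
lia.
Qed.

(** The squares have index 2: multiplication by a nonsquare [x] carries the
    squares into the nonsquares, hence onto them, as there are equally many. *)
Lemma nonsquareM x y :
  x != 0 -> x \notin S -> y != 0 -> y \notin S -> x * y \in S.
Proof.
move=> x0 Sx y0 Sy.
pose N := [set x | (x != 0) && (x \notin S)].
have xS : *%R x @: S = N.
  apply/eqP; rewrite eqEcard card_imset; last exact: mulfI.
  rewrite card_nonsquares leqnn andbT.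
  apply/subsetP => _ /imsetP[s Ss ->];
  rewrite inE mulf_neq0 ?(square_neq0 Ss) //=.
  by rewrite mulrC square_pMl.
have : y \in N by rewrite inE y0.
rewrite -xS => /imsetP[s Ss ->].
by rewrite mulrA mulrC square_pMl // -expr2 sqr_mem.
Qed.

Definition quadchar (x : F) : int :=
  if x == 0 then 0 else if x \in S then 1 else -1.
Local Notation chi := quadchar.

Lemma chi0 : chi 0 = 0. Proof. by rewrite /chi eqxx. Qed.
Lemma chi1 : chi 1 = 1. Proof. by rewrite /chi oner_eq0 one_square. Qed.

Lemma chiM x y : chi (x * y) = chi x * chi y.
Proof.
rewrite /chi mulf_eq0; have [_|x0] /= := eqVneq x 0; first by rewrite mul0r.
have [_|y0] := eqVneq y 0; first by rewrite mulr0.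
have [Sx|Sx] := boolP (x \in S); first by rewrite square_pMl // mul1r.
have [Sy|Sy] := boolP (y \in S).
  by rewrite mulrC square_pMl // (negbTE Sx).
by rewrite nonsquareM.
Qed.

Lemma chi_sqr x : chi x * chi x = (x != 0).
Proof. by rewrite /chi; case: eqP => //=; case: ifP. Qed.

(** Multiplication by a nonsquare permutes the field and changes every sign. *)
Lemma sum_chi : \sum_x chi x = 0.
Proof.
have /card_gt0P[n] : (0 < #|[set x | (x != 0%R) && (x \notin S)]|)%N.
  by rewrite card_nonsquares; apply/card_gt0P; exists 1; exact: one_square.
rewrite inE => /andP[n0 Sn].
have chin : chi n = -1 by rewrite /chi (negbTE n0) (negbTE Sn).
have : \sum_x chi x = - \sum_x chi x; last by lia.
rewrite [LHS](reindex_inj (mulfI n0)) -mulN1r big_distrr /=.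
by apply: eq_bigr => x _; rewrite chiM chin.
Qed.

(** For [x != 0], [chi x * chi (x + c) = chi (1 + c / x)], and [1 + c / x]
    takes every value but [1]; so the sum is that of [sum_chi] less [chi 1]. *)
Lemma autocorrelation c : c != 0 -> \sum_x chi x * chi (x + c) = -1.
Proof.
move=> c0.
transitivity (\sum_(x : F | x != 0) chi (1 + c * x)).
  rewrite (bigD1 0) //= chi0 mul0r add0r.
  rewrite (reindex_inj (@invr_inj F)) /=; apply: eq_big => x.
    by rewrite invr_eq0.
  rewrite invr_eq0 => x0.
  have -> : x^-1 + c = x^-1 * (1 + c * x).
    by rewrite mulrDr mulr1 mulrCA mulVf ?mulr1.
  by rewrite chiM mulrA chi_sqr invr_eq0 x0 mul1r.
have := sum_chi; rewrite (reindex (fun x => 1 + c * x)) /=.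
  rewrite (bigD1 0) //= mulr0 addr0 chi1 => /eqP.
  by rewrite addrC addr_eq0 => /eqP.
exists (fun y => c^-1 * (y - 1)) => y _.
  by rewrite addrC addrA addNr add0r mulKf.
by rewrite mulVKf // addrC subrK.
Qed.

Lemma sum_chi_sub u : \sum_w chi (w - u) = 0.
Proof. by rewrite -[RHS]sum_chi [RHS](reindex_inj (addIr (- u))). Qed.

Lemma correlation u v :
  \sum_w chi (w - u) * chi (w - v) = (u == v)%:R * q%:Z - 1.
Proof.
rewrite (reindex_inj (addIr u)) /=.
under eq_bigr do rewrite addrK -addrA.
have [->|uv] := eqVneq u v; last by rewrite autocorrelation ?subr_eq0 // mul0r.
under eq_bigr do rewrite subrr addr0 chi_sqr.
rewrite (bigD1 0) //= eqxx add0r.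
under eq_bigr => i i0 do rewrite i0.
rewrite sumr_const (cardC1 0) mul1r -[#|F|]prednK; last first.
  by apply/card_gt0P; exists 0.
lia.
Qed.

(** Up to the diagonal term, this is the number of neighbours of [w] in [A]
    minus the number of its non-neighbours there. In other words it is the
    image of the indicator of [A] under the Seidel matrix of the Paley graph
    (up to sign). *)
Definition chisum (A : {set F}) (w : F) : int := \sum_(u in A) chi (w - u).

Lemma sum_chisum A : \sum_w chisum A w = 0.
Proof.
by rewrite exchange_big big1 //= => u _; exact: sum_chi_sub.
Qed.

Lemma sum_chisum_sqr A : \sum_w chisum A w ^+ 2 = #|A|%:Z * (q%:Z - #|A|%:Z).
Proof.
transitivity (\sum_(u in A) \sum_(v in A) \sum_w chi (w - u) * chi (w - v)).
  under eq_bigr do rewrite expr2 big_distrl /=.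
  rewrite exchange_big; apply: eq_bigr => u _.
  by rewrite exchange_big; apply: eq_bigr => w _; exact: big_distrr.
under eq_bigr => u uA do under eq_bigr => v vA do rewrite correlation.
under eq_bigr => u uA.
  rewrite big_split /= sumr_const (bigD1 u) //= eqxx big1 ?addr0; last first.
    by move=> i /andP[_ /negbTE]; rewrite eq_sym => ->; rewrite mul0r.
  over.
by rewrite sumr_const mul1r -[LHS]mulr_natl mulNrn !natz.
Qed.

(** The Cauchy-Schwarz inequality, from the nonnegativity of the variance. *)
Lemma sum_sqr_le (A : {set F}) (f : F -> int) :
  (\sum_(x in A) f x) ^+ 2 <= #|A|%:Z * \sum_(x in A) f x ^+ 2.
Proof.
set T := \sum_(x in A) f x; set Q := \sum_(x in A) _.
have [/eqP|A0] := posnP #|A|.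
  by rewrite cards_eq0 => /eqP A0; rewrite /T A0 big_set0 expr0n /= cards0 mul0r.
have : 0 <= \sum_(x in A) (#|A|%:Z * f x - T) ^+ 2.
  by apply: sumr_ge0 => x _; rewrite sqr_ge0.
have -> : \sum_(x in A) (#|A|%:Z * f x - T) ^+ 2 =
          #|A|%:Z ^+ 2 * Q - #|A|%:Z * T ^+ 2.
  transitivity (\sum_(x in A)
      (#|A|%:Z ^+ 2 * f x ^+ 2 + (- (2 * #|A|%:Z * T)) * f x + T ^+ 2)).
    by apply: eq_bigr => x _; ring.
  rewrite !big_split /= sumr_const -!mulr_sumr -/T -/Q -mulr_natl natz.
  ring.
rewrite expr2 -mulrA -mulrBr pmulr_rge0 ?ltz_nat //.
by rewrite subr_ge0.
Qed.

Lemma chisum_setC (A : {set F}) :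
  \sum_(w in ~: A) chisum A w = - \sum_(w in A) chisum A w.
Proof.
have := sum_chisum A; rewrite (bigID (mem A)) /= => /eqP.
rewrite addrC addr_eq0 => /eqP<-.
by apply: eq_bigl => w; rewrite inE.
Qed.

(** The expander mixing inequality for the cut between [A] and its complement:
    every nontrivial eigenvalue of the Seidel matrix has square [q]. The sum
    of [chisum A] over the complement is the opposite of its sum over [A];
    Cauchy-Schwarz on the two parts, added up by [sum_chisum_sqr], gives it. *)
Lemma seidel_mixing (A : {set F}) : q%:Z * (\sum_(w in A) chisum A w) ^+ 2 <=
  (#|A|%:Z * (q%:Z - #|A|%:Z)) ^+ 2.
Proof.
have sumC (f : F -> int) : \sum_(w | w \notin A) f w = \sum_(w in ~: A) f w.
  by apply: eq_bigl => w; rewrite inE.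
have := chisum_setC A; set T := \sum_(w in A) _ => TC.
have := sum_chisum_sqr A; rewrite (bigID (mem A)) /= sumC.
have := sum_sqr_le A (chisum A); rewrite -/T.
have := sum_sqr_le (~: A) (chisum A); rewrite TC.
set QA := \sum_(w in A) _; set QC := \sum_(w in ~: A) _.
have <- : (#|A| + #|~: A| = q)%N by rewrite cardsC.
move: #|A| #|~: A| => a b; rewrite PoszD sqrrN addrAC subrr add0r => hC hA hAC.
have := ler_wpM2l (ler0n _ b) hA; have := ler_wpM2l (ler0n _ a) hC.
rewrite !natz => h1 h2.
have -> : (a%:Z * b%:Z) ^+ 2 = b%:Z * (a%:Z * QA) + a%:Z * (b%:Z * QC).
  by rewrite -[_ ^+ 2]/(_ * _) -{2}hAC; ring.
by rewrite mulrDl addrC lerD.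
Qed.
End QuadraticCharacter.

(** * Independent sets, triangles and cycles of the Paley graph *)

Section PaleyParameters.
Variables (F : finFieldType) (q : nat).
Hypotheses (Fq : #|F| = q) (q1 : q = 1 %[mod 4]) (two0 : 2 != 0 :> F).
Local Notation S := (nonzero_squares F).
Local Notation G := (paley_graph Fq q1).
Local Notation chi := (@quadchar F).

Lemma q_gt1 : (1 < q)%N. Proof. by rewrite -Fq card_finNzRing_gt1. Qed.

Lemma adjE u v : G u v = (u - v \in S). Proof. by []. Qed.

Lemma chi_adj u v : chi (u - v) = 2 * (G u v)%:Z - 1 + (u == v)%:Z.
Proof.
rewrite /quadchar adjE subr_eq0; have [->|uv] := eqVneq u v.
  by rewrite subrr (negbTE (contraL (@square_neq0 _ _) _)) ?negbK.
by case: ifP.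
Qed.

Definition degree_in (C : {set F}) x := #|[set y in C | G x y]|.

Lemma sum_constz (A : {set F}) (a : int) : \sum_(w in A) a = #|A|%:Z * a.
Proof. by rewrite sumr_const -mulr_natl natz. Qed.

Lemma sum_indicator (A : {set F}) (P : pred F) :
  \sum_(u in A) (P u)%:Z = #|[set u in A | P u]|%:Z.
Proof.
rewrite -[RHS]natz -sum1_card natr_sum big_mkcond [RHS]big_mkcond /=.
by apply: eq_bigr => u _; rewrite inE; case: (u \in A); case: (P u).
Qed.

Lemma chisum_degree_in (C : {set F}) x :
  chisum C x = 2 * (degree_in C x)%:Z - #|C|%:Z + (x \in C)%:Z.
Proof.
rewrite /chisum; under eq_bigr do rewrite chi_adj.
rewrite big_split sumrB -big_distrr /= sumr_const !natz !sum_indicator.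
congr (_ + _%:Z).
have [xC|xC] := boolP (x \in C).
  rewrite -[RHS](cards1 x); apply: eq_card => y.
  by rewrite !inE eq_sym andb_idl // => /eqP->.
rewrite -[RHS](@cards0 F); apply: eq_card => y; rewrite !inE.
by apply: contraNF xC => /andP[yC /eqP->].
Qed.

(** On an independent set [I] of size [s], [chisum I] is constantly [1 - s],
    so [seidel_mixing] reads [q * (s * (s - 1))^2 <= (s * (q - s))^2], that
    is, [(q - 1) * (s^2 - q) <= 0] unless [s = 0]. *)
Lemma independent_le (I : {set F}) :
  {in I &, forall u v, ~~ G u v} -> (#|I| ^ 2 <= q)%N.
Proof.
move=> indI; have := seidel_mixing two0 I.
have -> : \sum_(w in I) chisum I w = - (#|I|%:Z * (#|I|%:Z - 1)).
  transitivity (\sum_(w in I) - (#|I|%:Z - 1)); last first.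
    by rewrite sum_constz mulrN.
  apply: eq_bigr => w wI; rewrite chisum_degree_in wI.
  suff -> : degree_in I w = 0%N by lia.
  apply/eqP; rewrite cards_eq0 -subset0; apply/subsetP => u.
  by rewrite inE => /andP[uI]; rewrite (negbTE (indI _ _ wI uI)).
have := max_card I; rewrite Fq; have := q_gt1.
move: #|I| => s q_gt1 sq h.
have [->|s0] := posnP s; first by rewrite exp0n.
have {h} : (q%:Z - 1) * (s%:Z ^+ 2 - q%:Z) <= 0.
  have s2_gt0 : 0 < s%:Z ^+ 2 by rewrite exprn_gt0.
  rewrite -(pmulr_rle0 _ s2_gt0).
  have -> : s%:Z ^+ 2 * ((q%:Z - 1) * (s%:Z ^+ 2 - q%:Z)) =
     q%:Z * (- (s%:Z * (s%:Z - 1))) ^+ 2 - (s%:Z * (q%:Z - s%:Z)) ^+ 2 by ring.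
  by rewrite subr_le0.
by rewrite pmulr_rle0; lia.
Qed.

(** An edge lies in [(q - 5) / 4] triangles. Off the two ends, the product
    [(1 + chi (w - u)) * (1 + chi (w - v))] is 4 at the common neighbours and
    0 elsewhere; each end contributes 2; and the sum of all products is
    [q - 1]. *)
Lemma card_common u v : G u v -> (4 * #|[set w | G u w & G v w]| + 5 = q)%N.
Proof.
set W := [set w | _ & _] => uv.
have uDv : u != v by apply: contraTneq uv => ->; rewrite adj_irrefl.
have : \sum_w (1 + chi (w - u)) * (1 + chi (w - v)) = q%:Z - 1.
  transitivity (\sum_w (1 + chi (w - u) + chi (w - v) +
                        chi (w - u) * chi (w - v))).
    by apply: eq_bigr => w _; ring.
  rewrite !big_split /= !(sum_chi_sub two0) (correlation two0) (negbTE uDv).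
  by rewrite mul0r !addr0 sumr_const Fq natz.
have -> : \sum_w (1 + chi (w - u)) * (1 + chi (w - v)) =
  \sum_w (4 * (G u w && G v w)%:Z + 2 * (w == u)%:Z + 2 * (w == v)%:Z).
  apply: eq_bigr => w _; rewrite !chi_adj.
  rewrite ![G w _]adj_sym.
  have [->|wu] := eqVneq w u.
    by rewrite adj_irrefl (negbTE uDv) [G v u]adj_sym uv.
  have [->|wv] := eqVneq w v.
    by rewrite adj_irrefl uv.
  by case: (G u w); case: (G v w).
have sum1 a : \sum_w (w == a)%:Z = 1.
  by rewrite (bigD1 a) //= eqxx big1 // => w /negbTE->.
rewrite !big_split -!big_distrr /= !sum1.
have -> : \sum_w (G u w && G v w)%:Z =
          \sum_(w in [set: F]) (G u w && G v w)%:Z.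
  by apply: eq_bigl => w; rewrite inE.
rewrite sum_indicator.
have -> : [set w in [set: F] | G u w && G v w] = W.
  by apply/setP => w; rewrite !inE.
rewrite !mulr1; move: #|W| => n; lia.
Qed.

(** Let [T] be the sum of [chisum C] over the vertex set [C] of the cycle [c].
    The first bound holds because both ends of an edge of the cycle have all
    their common neighbours on it, so that every vertex of the cycle has
    there, besides its successor, at least [(q - 5) / 4] neighbours. The second
    holds because a vertex off the cycle has fewer than [s] neighbours on it,
    by [successors_independent] and [independent_le]. The third is
    [seidel_mixing]. *)
Lemma nonextendable_bounds c s : (3 <= size c)%N -> ucycle G c ->
  ~ has_cycle_of_length G (size c).+1 -> (q < s.+1 ^ 2)%N ->
  exists T : int, [/\ (size c)%:Z * (q%:Z + 1 - 2 * (size c)%:Z) <= 2 * T,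
     (q%:Z - (size c)%:Z) * ((size c)%:Z + 2 - 2 * s%:Z) <= T &
     q%:Z * T ^+ 2 <= ((size c)%:Z * (q%:Z - (size c)%:Z)) ^+ 2].
Proof.
move=> c3 uc noext qs; have /andP[cc uniqc] := uc.
pose C := [set y in c]; have kE : #|C| = size c.
  by rewrite cardsE; apply/card_uniqP.
pose T := \sum_(w in C) chisum C w; exists T.
have T3 := seidel_mixing two0 C; rewrite -/T kE Fq in T3; split => //.
  have d_in u : u \in c -> (q <= 4 * degree_in C u + 1)%N.
    move=> uc'; have un : G u (next c u) by apply: next_cycle.
    have := card_common un; set W := [set w | _ & _] => <-.
    have : (next c u |: W) \subset [set y in C | G u y].
      apply/subsetP => w /setU1P[->|]; rewrite !inE ?mem_next ?uc' //.
      case/andP=> uw uw'; rewrite uw andbT; apply: contraT => wc; case: noext.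
      by apply: cycle_insert uc wc uc' _ _; rewrite // adj_sym.
    move/subset_leq_card; rewrite cardsU1 inE adj_irrefl andbF /=.
    rewrite -/(degree_in C u); lia.
  have -> : (size c)%:Z * (q%:Z + 1 - 2 * (size c)%:Z) =
     \sum_(w in C) (q%:Z + 1 - 2 * (size c)%:Z).
    by rewrite sum_constz kE.
  rewrite /T mulr_sumr; apply: ler_sum => w wC.
  rewrite chisum_degree_in wC kE; rewrite inE in wC; have := d_in _ wC; lia.
have TC : \sum_(w in ~: C) chisum C w = - T by exact: chisum_setC.
have d_out x : x \notin c -> (degree_in C x < s)%N.
  move=> xc; have [I Icard indI] := successors_independent c3 uc xc noext.
  have := independent_le indI; rewrite Icard.
  have -> : [set y in c | G x y] = [set y in C | G x y].
    by apply/setP => y; rewrite !inE.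
  rewrite -/(degree_in C x) => h.
  rewrite -ltnS -(ltn_exp2r _ _ (_ : 0 < 2)%N) //.
  exact: leq_ltn_trans h qs.
rewrite -lerN2 -TC -mulrN.
have -> : (q%:Z - (size c)%:Z) * - ((size c)%:Z + 2 - 2 * s%:Z) =
     \sum_(w in ~: C) - ((size c)%:Z + 2 - 2 * s%:Z).
  rewrite sum_constz; congr (_ * _).
  have := cardsC C; rewrite Fq kE; lia.
apply: ler_sum => w; rewrite inE => wC; rewrite chisum_degree_in (negbTE wC) kE.
rewrite inE in wC; have := d_out _ wC; lia.
Qed.

End PaleyParameters.

(** * The arithmetic of the bounds *)

(** The orders [q] and lengths [k] for which the bounds of
    [nonextendable_bounds] are consistent. Some of them are genuine: in the
    graph of order 9, each edge lies in a single triangle and each vertex off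
    a triangle has one neighbour on it, so a triangle cannot be lengthened by
    the surgeries above. *)
Definition exceptional (q k : nat) :=
  (q, k) \in [:: (9, 3); (9, 4); (9, 5); (9, 6); (13, 5); (17, 7); (25, 10)]%N.

Lemma small_parameters q k s : q = 1 %[mod 4] -> (5 < q)%N -> (2 < k)%N ->
  (s ^ 2 <= q)%N -> (q < s.+1 ^ 2)%N -> (k <= 2 * s)%N ->
  q%:Z * (s%:Z - 2) + s%:Z <= 2 * k%:Z * (s%:Z - 1) -> (s <= 5)%N ->
  exceptional q k \/
    (s, q, k) \in [:: (3, 13, 4); (3, 13, 6); (4, 17, 8); (4, 21, 8)]%N.
Proof.
move=> q1 q5 k3 sq qs k2s qk s5; rewrite /exceptional !inE !xpair_eqE.
case: s sq qs k2s qk s5 => [|[|[|[|[|[|s]]]]]] //= sq qs k2s qk _.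
- lia.
- lia.
- lia.
- have : q = 9 \/ q = 13 by lia.
  case=> qE; subst q; lia.
- have : q = 17 \/ q = 21 by lia.
  case=> qE; subst q; lia.
have qE : q = 25 by lia.
subst q; lia.
Qed.

(** With [s] the integer part of the square root of [q], the last bound gives
    [s * T <= k * (q - k)]. Against the lower bounds on [T] it yields
    [k <= 2 * s] and [q * (s - 2) + s <= 2 * k * (s - 1)], so
    [s^2 - 6 * s + 5 <= 0] and [s <= 5]. Few pairs remain, and for four of
    them rounding the root of [q] to [s] lost too much: there the unrounded
    third inequality excludes the pair. *)
Lemma bounds_exceptional q k s (T : int) : q = 1 %[mod 4] -> (5 < q)%N ->
  (3 <= k < q)%N -> (s ^ 2 <= q < s.+1 ^ 2)%N ->
  k%:Z * (q%:Z + 1 - 2 * k%:Z) <= 2 * T ->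
  (q%:Z - k%:Z) * (k%:Z + 2 - 2 * s%:Z) <= T ->
  q%:Z * T ^+ 2 <= (k%:Z * (q%:Z - k%:Z)) ^+ 2 -> exceptional q k.
Proof.
move=> q1 q5 /andP[k3 kq] /andP[sq qs] T1 T2 T3.
have s2 : (2 <= s)%N.
  rewrite ltnNge; apply/negP => s1.
  have : (s.+1 ^ 2 <= 2 ^ 2)%N by rewrite leq_exp2r.
  lia.
have q_k : 0 < q%:Z - k%:Z by lia.
have P0 : 0 <= k%:Z * (q%:Z - k%:Z) by rewrite mulr_ge0 ?(ltW q_k).
have sT : s%:Z * T <= k%:Z * (q%:Z - k%:Z).
  have [T0|T0] := lerP T 0; first by apply: le_trans P0; rewrite mulr_ge0_le0.
  rewrite -ler_sqr ?nnegrE ?mulr_ge0 ?(ltW T0) ?(ltW q_k) //.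
  apply: le_trans T3; rewrite exprMn ler_wpM2r ?sqr_ge0 //; lia.
have k2s : (k <= 2 * s)%N.
  have : (q%:Z - k%:Z) * ((s%:Z - 1) * (k%:Z - 2 * s%:Z)) <= 0.
    have -> : (q%:Z - k%:Z) * ((s%:Z - 1) * (k%:Z - 2 * s%:Z)) =
       s%:Z * ((q%:Z - k%:Z) * (k%:Z + 2 - 2 * s%:Z)) - k%:Z * (q%:Z - k%:Z) by ring.
    by rewrite subr_le0; apply: le_trans sT; rewrite ler_wpM2l.
  rewrite pmulr_rle0 // pmulr_rle0; lia.
have qk : q%:Z * (s%:Z - 2) + s%:Z <= 2 * k%:Z * (s%:Z - 1).
  have : k%:Z * (q%:Z * (s%:Z - 2) + s%:Z - 2 * k%:Z * (s%:Z - 1)) <= 0.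
    have -> : k%:Z * (q%:Z * (s%:Z - 2) + s%:Z - 2 * k%:Z * (s%:Z - 1)) =
      s%:Z * (k%:Z * (q%:Z + 1 - 2 * k%:Z)) - 2 * (k%:Z * (q%:Z - k%:Z)) by ring.
    rewrite subr_le0; apply: (@le_trans _ _ (s%:Z * (2 * T))).
      by rewrite ler_wpM2l.
    by rewrite mulrCA ler_wpM2l.
  rewrite pmulr_rle0; lia.
have s5 : (s <= 5)%N.
  have : s%:Z * ((s%:Z - 1) * (s%:Z - 5)) <= 0.
    have h1 : s%:Z ^+ 2 * (s%:Z - 2) <= q%:Z * (s%:Z - 2).
      by rewrite ler_wpM2r; lia.
    have h2 : 2 * k%:Z * (s%:Z - 1) <= 4 * s%:Z * (s%:Z - 1).
      by rewrite ler_wpM2r; lia.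
    have -> : s%:Z * ((s%:Z - 1) * (s%:Z - 5)) =
      (s%:Z ^+ 2 * (s%:Z - 2) + s%:Z) - 4 * s%:Z * (s%:Z - 1) by ring.
    rewrite subr_le0; apply: le_trans h2; apply: le_trans qk; lia.
  rewrite pmulr_rle0; last by lia.
  rewrite pmulr_rle0; lia.
have far t : 0 <= t -> t <= T -> q%:Z * t ^+ 2 <= (k%:Z * (q%:Z - k%:Z)) ^+ 2.
  move=> t0 tT; apply: le_trans T3; rewrite ler_wpM2l // ler_sqr ?nnegrE //.
  exact: le_trans tT.
have := small_parameters q1 q5 k3 sq qs k2s qk s5.
case=> //; rewrite !inE => /or4P[] /eqP[sE qE kE]; subst s q k;
  clear -far T1 T2.
(* The instances of [far] are at the larger lower bound on [T]. *)
- have := far 12; lia.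
- have := far 14; lia.
- have := far 18; lia.
have := far 26; lia.
Qed.

(** * Explicit cycles and the induction on the length *)

Lemma two_neq0_of_card (F : finFieldType) (q : nat) : prime_power q ->
  q = 1 %[mod 4] -> #|F| = q -> 2 != 0 :> F.
Proof.
move=> [p [k [pp k0 qE]]] q1 Fq.
have pF : p \in [pchar F] by apply: (@card_finPcharP F p k) => //; rewrite Fq.
have [two0|//] := eqVneq (2 : F) 0.
have : (p %| 2)%N by rewrite (dvdn_pcharf pF) two0 eqxx.
rewrite dvdn_prime2 // => /eqP p2.
have : (2 %| q)%N by rewrite qE p2 dvdn_exp.
lia.
Qed.

Lemma has_cycle_map (T : eqType) (e : rel T) (P : pred T) (V : finType)
    (G : sgraph V) (f : T -> V) (s : seq T) :
  {in P &, injective f} -> {homo f : x y / e x y >-> G x y} ->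
  [&& (3 <= size s)%N, all P s & ucycleb e s] -> has_cycle_of_length G (size s).
Proof.
move=> f_inj f_homo /and3P[s3 /allP sP /andP[cyc_s uniq_s]]; split=> //.
exists (map f s); rewrite size_map; split=> //; apply/andP; split.
  exact: (homo_cycle f_homo).
by rewrite map_inj_in_uniq // => x y xs ys; apply: f_inj; apply: sP.
Qed.

Lemma natr_inj_ltn (R : nzRingType) p : p \in [pchar R] ->
  {in gtn p &, injective (fun n : nat => n%:R : R)}.
Proof.
move=> pR m n; rewrite !inE.
wlog le_nm : m n / (n <= m)%N.
  move=> hw mp np mn; case/orP: (leq_total n m) => le; first exact: hw.
  by apply/esym/hw.
move=> mp np /eqP; rewrite -subr_eq0 -natrB // -(dvdn_pcharf pR).
move=> /dvdnP[[|d] E]; first by lia.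
nia.
Qed.

(** The fixed points of [t |-> t ^+ p] are roots of ['X^p - 'X], hence at most
    [p] in number; in characteristic [p] they form the prime field. *)
Lemma exists_expr_neq (F : finFieldType) p (A : {set F}) : (1 < p)%N ->
  (p < #|A|)%N -> exists2 t, t \in A & t ^+ p != t.
Proof.
move=> p1 pA; have [/exists_inP[t tA tp]|/exists_inPn none] :=
  boolP [exists t in A, t ^+ p != t]; first by exists t.
have szX : size ('X^p - 'X : {poly F}) = p.+1.
  by rewrite size_polyDl size_polyXn // size_polyN size_polyX.
have Xn0 : ('X^p - 'X : {poly F}) != 0 by rewrite -size_poly_eq0 szX.
have roots : all (root ('X^p - 'X)) (enum A).
  apply/allP => t; rewrite mem_enum => /none; rewrite negbK => /eqP tp.
  by rewrite rootE !hornerE tp subrr.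
have := max_poly_roots Xn0 roots (enum_uniq _).
by rewrite szX -cardE ltnS leqNgt pA.
Qed.

Section PaleyCycles.
Variables (F : finFieldType) (q : nat).
Hypotheses (Fq : #|F| = q) (q1 : q = 1 %[mod 4]).
Local Notation S := (nonzero_squares F).
Local Notation G := (paley_graph Fq q1).

Lemma paley_adj_add (u d : F) : d \in S -> G u (u + d).
Proof. by move=> Sd; rewrite adj_sym adjE addrAC subrr add0r. Qed.

(** 1 and 4 are nonzero squares in every field of odd characteristic, so these
    steps are edges for the two orders 13 and 17 alike. *)
Definition step14 : rel nat :=
  fun m n => [|| n == m.+1, m == n.+1, n == (m + 4)%N | m == (n + 4)%N].

Lemma paley_step14 : 2 != 0 :> F ->
  {homo (fun n : nat => n%:R : F) : m n / step14 m n >-> G m n}.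
Proof.
move=> two0 m n; have S4 : 4%:R \in S.
  by rewrite -[4%:R]/((2 * 2)%:R) natrM -expr2 sqr_mem.
case/or4P=> /eqP->.
- by rewrite -natr1; apply/paley_adj_add/one_square.
- by rewrite adj_sym -natr1; apply/paley_adj_add/one_square.
- by rewrite natrD; apply: paley_adj_add.
by rewrite adj_sym natrD; apply: paley_adj_add.
Qed.

(** The Cartesian product of two [p]-cycles. It embeds in the Paley graph of
    order [p^2] by [(a, b) |-> a + b * t], for [t] a square off the prime
    field, since its steps add or subtract [1] or [t]. *)
Definition torus_step p : rel (nat * nat) := fun a b =>
  (a.2 == b.2) && ((b.1 == a.1.+1 %[mod p]) || (a.1 == b.1.+1 %[mod p])) ||
  (a.1 == b.1) && ((b.2 == a.2.+1 %[mod p]) || (a.2 == b.2.+1 %[mod p])).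

Lemma paley_torus p t : p \in [pchar F] -> t \in S ->
  {homo (fun a : nat * nat => a.1%:R + a.2%:R * t) :
    a b / torus_step p a b >-> G a b}.
Proof.
move=> pF tS.
have natr_mod (m n : nat) : m = n %[mod p] -> m%:R = n%:R :> F.
  by move=> mn; rewrite -(GRing.natr_mod_pchar pF m) mn GRing.natr_mod_pchar.
move=> [a b] [c d]; rewrite /torus_step; cbn [fst snd].
case/orP=> /andP[/eqP-> /orP[]] /eqP/natr_mod ->; rewrite -natr1.
- by rewrite addrAC; apply: paley_adj_add; apply: one_square.
- by rewrite adj_sym addrAC; apply: paley_adj_add; apply: one_square.
- by rewrite mulrDl mul1r addrA; apply: paley_adj_add.
by rewrite adj_sym mulrDl mul1r addrA; apply: paley_adj_add.
Qed.

(** A coincidence of two points with distinct second coordinates would express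
    [t] as a quotient of integers, which the Frobenius automorphism fixes. *)
Lemma torus_inj p (t : F) : p \in [pchar F] -> t ^+ p != t ->
  {in [pred a : nat * nat | (a.1 < p)%N && (a.2 < p)%N] &,
     injective (fun a : nat * nat => a.1%:R + a.2%:R * t : F)}.
Proof.
move=> pF tp [a b] [c d]; rewrite !inE /= => /andP[ap bp] /andP[cp dp] E.
have bd : b = d.
  apply: (natr_inj_ltn pF); rewrite ?inE //; apply: contraNeq tp => bd.
  have -> : t = (c%:R - a%:R) / (b%:R - d%:R).
    apply: (canRL (mulfK _)); first by rewrite subr_eq0.
    apply/eqP; rewrite -subr_eq0; apply/eqP.
    by rewrite -[RHS](subrr (c%:R + d%:R * t)) -{1}E; ring.
  by rewrite -(pFrobenius_autE pF) fmorph_div !rmorphB /= !rmorph_nat.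
by move: E; rewrite bd => /addIr/(natr_inj_ltn pF)->.
Qed.

Lemma exceptional_cycle k :
  2 != 0 :> F -> exceptional q k -> has_cycle_of_length G k.+1.
Proof.
move=> two0.
have char p n : prime p -> q = (p ^ n)%N -> p \in [pchar F].
  by move=> pp qE; apply: (@card_finPcharP F p n) => //; rewrite Fq.
have prime_case p (s : seq nat) : prime p -> q = p ->
    [&& (3 <= size s)%N, all (gtn p) s & ucycleb step14 s] ->
    has_cycle_of_length G (size s).
  move=> pp qE; apply: has_cycle_map (paley_step14 two0).
  by apply: natr_inj_ltn; apply: (char p 1%N); rewrite ?expn1.
have torus_case p (s : seq (nat * nat)) :
    prime p -> q = (p ^ 2)%N -> (p < #|S|)%N ->
    [&& (3 <= size s)%N, all [pred a | (a.1 < p)%N && (a.2 < p)%N] s &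
      ucycleb (torus_step p) s] -> has_cycle_of_length G (size s).
  move=> pp qE pS; have pF := char p 2%N pp qE.
  have [t tS tp] := exists_expr_neq (prime_gt1 pp) pS.
  exact: has_cycle_map (torus_inj pF tp) (paley_torus pF tS).
have := card_squares two0; rewrite Fq => cS.
rewrite /exceptional !inE !xpair_eqE => kE.
do 6?[case/orP: kE => kE]; case/andP: kE => /eqP qE /eqP->.
- by apply: (torus_case 3 [:: (0, 0); (1, 0); (1, 1); (0, 1)]%N) => //; lia.
- apply: (torus_case 3 [:: (0, 0); (1, 0); (2, 0); (2, 1); (0, 1)]%N) => //.
  lia.
- apply: (torus_case 3 [:: (0, 0); (1, 0); (2, 0); (2, 1); (1, 1);
    (0, 1)]%N) => //; lia.
- apply: (torus_case 3 [:: (0, 0); (1, 0); (2, 0); (2, 1); (1, 1); (0, 1);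
    (0, 2)]%N) => //; lia.
- exact: (prime_case 13 [:: 0; 1; 2; 6; 5; 4]%N).
- exact: (prime_case 17 [:: 0; 1; 2; 3; 7; 6; 5; 4]%N).
(* The 5-cycle of the points [(a, 0)], three of whose edges are replaced by
   detours of length 3. *)
apply: (torus_case 5 [:: (0, 0); (0, 1); (1, 1); (1, 0); (1, 4); (2, 4);
  (2, 0); (2, 1); (3, 1); (3, 0); (4, 0)]%N) => //; lia.
Qed.

Lemma has_triangle : 2 != 0 :> F -> (5 < q)%N -> has_cycle_of_length G 3.
Proof.
move=> two0 q5; split=> //.
have G01 : G 0 1 by rewrite -[X in G 0 X]add0r; apply/paley_adj_add/one_square.
have := card_common two0 G01; set W := [set w | _ & _] => cardW.
have /card_gt0P[w] : (0 < #|W|)%N by lia.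
rewrite inE => /andP[G0w G1w]; exists [:: 0; 1; w]; split=> //.
have neq u v : G u v -> u != v by apply: contraTneq => ->; rewrite adj_irrefl.
have cyc : [&& G 0 1, G 1 w & G w 0] by rewrite G01 G1w adj_sym.
apply/andP; split; first by rewrite /= andbT.
by rewrite /= !inE negb_or !neq.
Qed.

(** If there is no cycle of length [k + 1], then the bounds of
    [nonextendable_bounds] hold, so that the pair [(q, k)] is exceptional; but
    then [exceptional_cycle] exhibits one. *)
Lemma next_length k : 2 != 0 :> F -> (5 < q)%N -> (3 <= k < q)%N ->
  has_cycle_of_length G k -> has_cycle_of_length G k.+1.
Proof.
move=> two0 q5 /andP[k3 kq] [_ [c [ck uc]]].
have [/existsP[c' uc']|none] := boolP [exists c' : k.+1.-tuple F, ucycleb G c'].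
  by split; [exact: leqW | exists c'; rewrite size_tuple].
have noext : ~ has_cycle_of_length G (size c).+1.
  rewrite ck => -[_ [c' [sz uc']]]; case/existsP: none.
  by exists (Tuple (introT eqP sz)).
have [s sq smax] : exists2 s, (s ^ 2 <= q)%N & (q < s.+1 ^ 2)%N.
  have ex0 : exists s, (s ^ 2 <= q)%N by exists 0%N; rewrite exp0n.
  have bound s : (s ^ 2 <= q)%N -> (s <= q)%N.
    by apply: leq_trans; case: s => // s; rewrite -mulnn leq_pmulr.
  case: (ex_maxnP ex0 bound) => s sq smax; exists s => //.
  by rewrite ltnNge; apply/negP => /smax; rewrite ltnn.
rewrite -ck in k3 kq *.
have [T [T1 T2 T3]] := nonextendable_bounds two0 k3 uc noext smax.
apply: exceptional_cycle => //.
apply: (bounds_exceptional q1 q5 _ _ T1 T2 T3); first by rewrite k3.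
by rewrite sq.
Qed.
End PaleyCycles.

Local Close Scope ring_scope.

Theorem corollary1p3 (q : nat) (q_pp : prime_power q) (q1 : q = 1 %[mod 4])
  (q_neq5 : q <> 5) (F : finFieldType) (Fq : #|F| = q) :
  pancyclic (paley_graph Fq q1).
Proof.
have two0 := two_neq0_of_card q_pp q1 Fq.
have q_gt1 : (1 < q)%N by rewrite -Fq card_finNzRing_gt1.
have q5 : (5 < q)%N by lia.
split; first by rewrite Fq; lia.
rewrite Fq; elim=> [|k IHk] // /andP[k3 kq].
move: k3; rewrite leq_eqVlt => /orP[/eqP<-|k3]; first exact: has_triangle.
apply: next_length => //; first by rewrite -ltnS k3.
by apply: IHk; rewrite -ltnS k3 ltnW.
Qed.
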